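(* Let $0<p,q<\infty$. (i) If $0<p<q\le 1$, then $(\ell_p,d_p)$ Lipschitz embeds into $(\ell_q,d_q)$. (ii) If $0<p\le 1<q$, then $(\ell_p,d_p^{1/q})$ Lipschitz embeds into $\ell_q$ (with its norm metric). (iii) If $1\le p\le q$, then $\ell_p$ equipped with the metric $\|x-y\|_{\ell_p}^{p/q}$ Lipschitz embeds into $\ell_q$ (with its norm metric).
   Context: All sequence spaces are real. For $0<p\le 1$, the metric $d_p$ on $\ell_p$ is $d_p(x,y)=\sum_{n=1}^\infty|x_n-y_n|^p$; for $p\ge 1$, $d_p$ is the norm metric $d_p(x,y)=\|x-y\|_{\ell_p}=(\sum_{n=1}^\infty|x_n-y_n|^p)^{1/p}$. For a metric $d$ and $0<s\le1$, $d^s$ denotes the metric $(x,y)\mapsto d(x,y)^s$. A metric space $(\mathcal M_1,d_1)$ Lipschitz embeds into $(\mathcal M_2,d_2)$ if there are a one-to-one map $f:\mathcal M_1\to\mathcal M_2$ and constants $A,B>0$ with $A^{-1}d_1(x,y)\le d_2(f(x),f(y))\le B\,d_1(x,y)$ for all $x,y\in\mathcal M_1$. *)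

(* Defs.v *)
From mathcomp Require Import all_boot all_order all_algebra.
From mathcomp Require Import all_classical all_reals all_analysis.
Import Order.TTheory GRing.Theory Num.Theory.
Import numFieldNormedType.Exports.

Set Implicit Arguments.
Unset Strict Implicit.
Unset Printing Implicit Defensive.

Local Open Scope classical_set_scope.
Local Open Scope ring_scope.

Definition ell (R : realType) (p : R) : set R^nat :=
  [set x | cvgn (series (fun n => `|x n| `^ p))].

(* [limn] is total; for 0 < p the series below converges whenever
   [x] and [y] are in [ell p], since [ell p] is then a vector space. *)
Definition ell_sum (R : realType) (p : R) (x y : ell p) : R :=
  limn (series (fun n => `|val x n - val y n| `^ p)).

Definition ell_norm_dist (R : realType) (p : R) (x y : ell p) : R :=
  ell_sum x y `^ p^-1.

(* Both branches agree at p = 1. *)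
Definition ell_dist (R : realType) (p : R) (x y : ell p) : R :=
  if p <= 1 then ell_sum x y else ell_norm_dist x y.

Definition snowflake (R : realType) (T : Type) (d : T -> T -> R) (s : R) :
    T -> T -> R :=
  fun x y => d x y `^ s.

Definition lipschitz_embeds (R : realType) (T1 T2 : Type)
    (d1 : T1 -> T1 -> R) (d2 : T2 -> T2 -> R) : Prop :=
  exists f : T1 -> T2, injective f /\
  exists A B : R, [/\ 0 < A, 0 < B &
    forall x y, A^-1 * d1 x y <= d2 (f x) (f y) <= B * d1 x y].

(* Main.v *)
Require Import Defs.
From HB Require Import structures.
From mathcomp Require Import all_boot all_order all_algebra.
From mathcomp Require Import all_classical all_reals all_analysis.
From mathcomp Require Import ring lra.
Import Order.TTheory GRing.Theory Num.Theory.
Import numFieldNormedType.Exports.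
Local Open Scope classical_set_scope.
Local Open Scope ring_scope.

(** All three parts are one statement about the power sums
    S_r(x, y) = sum_n |x_n - y_n|^r.  Every metric involved is a power of S_p
    or S_q: d_p is S_p for p <= 1 and S_p^(1/p) for p >= 1, and in (ii) and
    (iii) both sides are the (1/q)-th powers of S_p and S_q.  As a two-sided
    comparison of distances survives taking a power
    ([lipschitz_embeds_snowflake]), it is enough to map l_p into l_q so that
    S_q of the images is comparable to S_p ([ell_sum_embeds]).  For p = q the
    identity does it; let p < q.

    Since S_p and S_q are sums over coordinates, it suffices to treat a single
    coordinate ([ell_sum_embeds_coordinatewise]): find countably many functions
    phi_i on the line, vanishing at 0, with
       sum_i |phi_i(s) - phi_i(t)|^q  comparable to  |s - t|^p,
    and send x to the family of all phi_i(x_n).  Such functions come from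
    discretising, along the geometric scales u = e^k, the identity
       int_0^oo |e^(ius) - e^(iut)|^q u^(-p-1) du = const * |s - t|^p.
    Explicitly, for every integer k take e^(-kp/q) times the two real
    coordinates of e^(i e^k t) - 1 ([trig_coord]).  Write d = |s - t|.

    Upper bound ([trig_coord_upper]): the k-th pair contributes at most a
    constant times e^(-kp) min(1, e^k d)^q, which is of order d^p for
    e^k close to 1/d and decays geometrically on both sides of that scale:
    like e^(-kp) for large k, because p > 0, and like e^(k(q-p)) for k going
    to -oo, because p < q ([trig_coord_decay]).

    Lower bound ([trig_coord_lower]): at the scale k with 1/e <= e^k d < 1 the
    two points e^(i e^k s), e^(i e^k t) of the circle are at a distance bounded
    below, and e^(-kp) is at least d^p; that one term is enough. *)

(** * Snowflaking both sides of an embedding *)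

Lemma lipschitz_embeds_snowflake (R : realType) (T1 T2 : Type)
    (d1 : T1 -> T1 -> R) (d2 : T2 -> T2 -> R) (s : R) :
  0 <= s -> (forall x y, 0 <= d1 x y) -> (forall x y, 0 <= d2 x y) ->
  lipschitz_embeds d1 d2 ->
  lipschitz_embeds (snowflake d1 s) (snowflake d2 s).
Proof.
move=> s0 d1_ge0 d2_ge0 [f [f_inj [A [B [A0 B0 fAB]]]]].
exists f; split=> //; exists (A `^ s), (B `^ s); rewrite !powR_gt0//; split=> //.
move=> x y; have /andP[lo hi] := fAB x y.
have Ai0 : 0 <= A^-1 by rewrite invr_ge0 ltW.
rewrite /snowflake -powR_inv1 ?powR_ge0// powRAC powR_inv1 ?(ltW A0)//.
rewrite -(powRM _ Ai0 (d1_ge0 x y)) -(powRM _ (ltW B0) (d1_ge0 x y)).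
by apply/andP; split; apply: ge0_ler_powR => //;
  rewrite nnegrE ?mulr_ge0// ?(ltW B0).
Qed.

(** * Series of nonnegative reals as unordered sums

    Unordered sums over countable types are what makes it possible to exchange
    summations, to enumerate the family (n, i) by natural numbers, and to shift
    the summation over scales, all before finiteness is known. *)

Section nonnegative_series.
Context {R : realType}.

Lemma cvgn_series_esum (a : R^nat) : (forall n, 0 <= a n) ->
  (\esum_(n in [set: nat]) (a n)%:E < +oo)%E -> cvgn (series a).
Proof.
move=> a0 afin; apply: nnseries_is_cvg => //.
by rewrite nneseries_esumT// => n; rewrite lee_fin.
Qed.

Lemma limn_series_esum (a : R^nat) : (forall n, 0 <= a n) ->
  cvgn (series a) ->
  (limn (series a))%:E = (\esum_(n in [set: nat]) (a n)%:E)%E.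
Proof.
move=> a0 ca; rewrite -nneseries_esumT; last by move=> n; rewrite lee_fin.
rewrite -EFin_lim//; congr (limn _); apply/funext => n /=.
by rewrite /series/= sumEFin.
Qed.

Lemma esum_ge1 {T : choiceType} (a : T -> \bar R) (i : T) :
  (forall j, (0 <= a j)%E) -> (a i <= \esum_(j in [set: T]) a j)%E.
Proof.
move=> a0; apply: esum_ge; exists [set i]; last by rewrite fsbig_set1.
by split=> //; exact: finite_set1.
Qed.

Lemma esum_int (a : int -> \bar R) : (forall k, (0 <= a k)%E) ->
  (\esum_(k in [set: int]) a k =
   \esum_(n in [set: nat]) a (Posz n) + \esum_(n in [set: nat]) a (Negz n))%E.
Proof.
move=> a0; rewrite (esumID (range Posz))// !setTI; congr (_ + _)%E.
  by rewrite esum_image// => m n _ _ [].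
rewrite (_ : ~` _ = range Negz); last first.
  apply/seteqP; split=> [[n|n]|_ [n _ <-]] /=; [|by exists n|by case].
  by move=> []; exists n.
by rewrite esum_image// => m n _ _ [].
Qed.

Lemma esum_prod_bool {T : choiceType} (a : T * bool -> \bar R) :
  (forall i, (0 <= a i)%E) ->
  (\esum_(i in [set: T * bool]) a i =
   \esum_(t in [set: T]) a (t, true) + \esum_(t in [set: T]) a (t, false))%E.
Proof.
move=> a0; rewrite (esumID (range (fun t => (t, true))))// !setTI.
congr (_ + _)%E; first by rewrite esum_image// => m n _ _ [].
rewrite (_ : ~` _ = range (fun t => (t, false))); last first.
  apply/seteqP; split=> [[t []]|_ [t _ <-]] /=; [|by exists t|by case].
  by move=> []; exists t.
by rewrite esum_image// => m n _ _ [].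
Qed.

Lemma esum_geometric (c z : R) : 0 <= c -> 0 < z < 1 ->
  (\esum_(n in [set: nat]) (c * z ^+ n)%:E = (c / (1 - z))%:E)%E.
Proof.
move=> c0 /andP[z0 z1].
have z1' : `|z| < 1 by rewrite ger0_norm// ltW.
have cv := @cvg_geometric_series _ c z z1'.
rewrite -(@limn_series_esum (geometric c z)) /=; last 2 first.
- by move=> n; rewrite mulr_ge0// exprn_ge0// ltW.
- exact: cvgP cv.
by congr EFin; apply: cvg_lim cv.
Qed.

End nonnegative_series.

(** * The power sum on l_p *)

Section ell_space.
Context {R : realType}.
Implicit Type p : R.

(** The constant [2 `^ p] covers p < 1 and p > 1 at once: |a - b| is at most
    twice the larger of |a| and |b|. *)
Lemma powR_norm_subr_le p (a b : R) : 0 <= p ->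
  `|a - b| `^ p <= 2 `^ p * (`|a| `^ p + `|b| `^ p).
Proof.
move=> p0; wlog ab : a b / `|a| <= `|b|.
  move=> H; case: (leP `|a| `|b|) => [/H//|/ltW ba].
  by rewrite distrC [X in _ * X]addrC; exact: H.
apply: (@le_trans _ _ ((2 * `|b|) `^ p)).
  rewrite ge0_ler_powR ?nnegrE ?mulr_ge0//.
  by rewrite (le_trans (ler_normB _ _))// mulrDl mul1r lerD2r.
by rewrite powRM// ler_wpM2l ?powR_ge0// lerDr powR_ge0.
Qed.

Lemma ell_sum_cvg p (x y : ell p) : 0 <= p ->
  cvgn (series (fun n => `|val x n - val y n| `^ p)).
Proof.
move=> p0; have /set_mem cx := valP x; have /set_mem cy := valP y.
apply: (@series_le_cvg _ _
    (fun n => 2 `^ p * (`|val x n| `^ p + `|val y n| `^ p))) => [n|n|n|].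
- exact: powR_ge0.
- by rewrite mulr_ge0 ?addr_ge0 ?powR_ge0.
- exact: powR_norm_subr_le.
- have -> : (fun n => 2 `^ p * (`|val x n| `^ p + `|val y n| `^ p)) =
      2 `^ p *: ((fun n => `|val x n| `^ p) + (fun n => `|val y n| `^ p)).
    by apply/funext.
  exact/is_cvg_seriesZ/is_cvg_seriesD.
Qed.

Lemma ell_sumE p (x y : ell p) : 0 <= p ->
  ((ell_sum x y)%:E =
   \esum_(n in [set: nat]) (`|val x n - val y n| `^ p)%:E)%E.
Proof.
by move=> p0; apply: limn_series_esum; last exact: ell_sum_cvg.
Qed.

Lemma ell_sum_ge0 p (x y : ell p) : 0 <= p -> 0 <= ell_sum x y.
Proof.
by move=> p0; rewrite -lee_fin ell_sumE// esum_ge0.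
Qed.

Lemma ell_sumxx p (x : ell p) : 0 < p -> ell_sum x x = 0.
Proof.
move=> p0; apply: EFin_inj; rewrite ell_sumE ?(ltW p0)//.
by apply: esum1 => n _; rewrite subrr normr0 powR0 ?gt_eqF.
Qed.

Lemma ell_sum_eq0 p (x y : ell p) : 0 < p -> ell_sum x y = 0 -> x = y.
Proof.
move=> p0 xy0; apply/val_inj/funext => n.
have := @esum_ge1 R _ (fun n => (`|val x n - val y n| `^ p)%:E) n.
rewrite -ell_sumE ?(ltW p0)// xy0 lee_fin => /(_ _)/wrap[j|le0].
  by rewrite lee_fin powR_ge0.
have /eqP : `|val x n - val y n| `^ p = 0.
  by apply/le_anti; rewrite le0 powR_ge0.
by rewrite powR_eq0 normr_eq0 subr_eq0 => /andP[/eqP].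
Qed.

End ell_space.

(** * Reduction to a single coordinate *)

Section coordinatewise.
Context {R : realType}.

Lemma natprod_enum (I : countType) (i0 : I) :
  exists e : nat -> nat * I, set_bij setT setT e.
Proof.
pose P : pointedType := HB.pack (nat * I)%type
  (isPointed.Build (nat * I)%type (0%N, i0)).
have inf : infinite_set [set: nat * I].
  move=> fin; apply: infinite_nat.
  apply: (@sub_finite_set _ _ (fst @` [set: nat * I])).
    by move=> n _; exists (n, i0).
  exact: finite_image.
have := eq_card_nat (countableP [set: nat * I]) inf.
by move=> /card_esym/(@card_set_bijP nat P).
Qed.

(** Summing the bounds at the points [x n], [y n] over n gives the comparison of
    power sums.  The bound against the zero sequence, at which every
    [phi i] vanishes, shows that the image of l_p lies in l_q, and injectivity
    is a consequence of the lower bound. *)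
Lemma ell_sum_embeds_coordinatewise (I : countType) (i0 : I)
    (phi : I -> R -> R) (p q c C : R) :
  0 < p -> 0 < q -> 0 < c -> 0 < C ->
  (forall i, phi i 0 = 0) ->
  (forall s t, ((c * `|s - t| `^ p)%:E <=
     \esum_(i in [set: I]) (`|phi i s - phi i t| `^ q)%:E)%E) ->
  (forall s t, (\esum_(i in [set: I]) (`|phi i s - phi i t| `^ q)%:E <=
     (C * `|s - t| `^ p)%:E)%E) ->
  lipschitz_embeds (@ell_sum R p) (@ell_sum R q).
Proof.
move=> p0 q0 c0 C0 phi0 lo hi.
have [e e_bij] := natprod_enum I i0.
have scale (a : R) (x y : ell p) : 0 <= a ->
    (\esum_(n in [set: nat]) (a * `|val x n - val y n| `^ p)%:E =
     (a * ell_sum x y)%:E)%E.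
  move=> a0; rewrite EFinM ell_sumE ?(ltW p0)// -!nneseries_esumT; last 2 first.
  - by move=> n; rewrite lee_fin powR_ge0.
  - by move=> n; rewrite lee_fin mulr_ge0// powR_ge0.
  by rewrite -nneseriesZl.
pose F (x : R^nat) : R^nat := fun n => phi (e n).2 (x (e n).1).
have FE (x y : R^nat) :
  (\esum_(n in [set: nat]) (`|F x n - F y n| `^ q)%:E =
   \esum_(n in [set: nat])
     \esum_(i in [set: I]) (`|phi i (x n) - phi i (y n)| `^ q)%:E)%E.
  rewrite esum_esum// (_ : _ `*`` _ = [set: nat * I]); last by apply/seteqP; split.
  by rewrite (reindex_esum _ _ _ _ e_bij).
have Flo (x y : ell p) : ((c * ell_sum x y)%:E <=
    \esum_(n in [set: nat]) (`|F (val x) n - F (val y) n| `^ q)%:E)%E.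
  by rewrite FE -scale ?(ltW c0)//; apply: le_esum => n _.
have Fhi (x y : ell p) : (\esum_(n in [set: nat])
    (`|F (val x) n - F (val y) n| `^ q)%:E <= (C * ell_sum x y)%:E)%E.
  by rewrite FE -scale ?(ltW C0)//; apply: le_esum => n _.
have zeroP : (fun=> 0 : R) \in ell p.
  rewrite inE /ell/=; apply: cvgn_series_esum => [n|]; first exact: powR_ge0.
  by rewrite esum1// => n _; rewrite normr0 powR0 ?gt_eqF.
(* Comparing with the zero sequence bounds the image itself. *)
pose z : ell p := SigSub zeroP.
have F_ell (x : ell p) : F (val x) \in ell q.
  rewrite inE /ell/=; apply: cvgn_series_esum => [n|]; first exact: powR_ge0.
  apply: le_lt_trans (ltry (C * ell_sum x z)).
  apply: le_trans (Fhi x z); apply: le_esum => n _.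
  by rewrite /F/= phi0 subr0.
pose f (x : ell p) : ell q := SigSub (F_ell x).
have fP (x y : ell p) : c * ell_sum x y <= ell_sum (f x) (f y) <= C * ell_sum x y.
  by rewrite -!lee_fin (ell_sumE q (f x)) ?(ltW q0)// Flo Fhi.
exists f; split.
  move=> x y fxy; apply: ell_sum_eq0 => //; apply/le_anti.
  rewrite ell_sum_ge0 ?(ltW p0)// andbT.
  have := fP x y; rewrite fxy ell_sumxx// => /andP[+ _].
  by rewrite pmulr_rle0.
exists c^-1, C; rewrite invr_gt0 invrK; split=> //.
Qed.

End coordinatewise.

(** * The trigonometric snowflake of the real line *)

Section trigonometric_snowflake.
Context {R : realType}.

Lemma norm_sin_le (x : R) : `|sin x| <= `|x|.
Proof.
wlog x0 : x / 0 <= x.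
  move=> H; case: (leP 0 x) => [/H//|/ltW x0].
  by rewrite -normrN -sinN -(normrN x) H// oppr_ge0.
have [c _] := @MVT_segment R sin cos 0 x x0 (fun y _ => is_derive_sin y)
  (continuous_subspaceT (@continuous_sin R)).
rewrite sin0 !subr0 => ->.
by rewrite normrM ler_piMl// cos_max.
Qed.

(** The real coordinates of exp(it) - 1; the shift by 1 makes both vanish at 0
    and disappears in differences. *)
Definition circle (b : bool) (t : R) : R := if b then sin t else cos t - 1.

(** The direction factors of the sum-to-product formulas, see
    [circle_chord]: up to sign, the coordinates of the unit vector parallel
    to the chord from exp(iu) to exp(iv), where m = (u + v) / 2. *)
Definition chord (b : bool) (m : R) : R := if b then cos m else sin m.

Lemma circle_chord b (u v : R) :
  `|circle b u - circle b v| =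
  2 * `|chord b ((u + v) / 2)| * `|sin ((u - v) / 2)|.
Proof.
set m := (u + v) / 2; set h := (u - v) / 2.
have -> : u = m + h by rewrite /m /h; field.
have -> : v = m - h by rewrite /m /h; field.
rewrite -[X in X * _ * _](@ger0_norm R 2)// -!normrM; case: b => /=.
  by congr `|_|; rewrite sinD sinB; ring.
by rewrite -[RHS]normrN; congr `|_|; rewrite cosD cosB; ring.
Qed.

Lemma chord_le1 b (m : R) : `|chord b m| <= 1.
Proof. by case: b; [exact: cos_max|exact: sin_max]. Qed.

Lemma chord_ge_half (m : R) : exists b, 2^-1 <= `|chord b m|.
Proof.
have := cos2Dsin2 m; rewrite -(real_normK (num_real (cos m))).
rewrite -(real_normK (num_real (sin m))) => cs.
have [|c2] := leP 2^-1 `|cos m|; first by exists true.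
have [|s2] := leP 2^-1 `|sin m|; first by exists false.
have := normr_ge0 (cos m); have := normr_ge0 (sin m); nra.
Qed.

Lemma circle_le2 b (u v : R) : `|circle b u - circle b v| <= 2.
Proof.
rewrite circle_chord -mulrA ler_piMr// mulr_ile1//; first exact: chord_le1.
exact: sin_max.
Qed.

Lemma circle_lip b (u v : R) : `|circle b u - circle b v| <= `|u - v|.
Proof.
rewrite circle_chord.
have := norm_sin_le ((u - v) / 2); rewrite normrM (@ger0_norm R 2^-1)// => h1.
have := chord_le1 b ((u + v) / 2) => h2.
have := normr_ge0 (chord b ((u + v) / 2)); have := normr_ge0 (sin ((u - v) / 2)).
nra.
Qed.

(** The chord has length 2 |sin ((u - v) / 2)|, and its direction, being a unit
    vector, has a coordinate of size at least 1/2. *)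
Lemma circle_ge (u v : R) :
  exists b, `|sin ((u - v) / 2)| <= `|circle b u - circle b v|.
Proof.
have [b bP] := chord_ge_half ((u + v) / 2); exists b; rewrite circle_chord.
by rewrite ler_peMl// -ler_pdivrMl// mulr1.
Qed.

(** The weight exp(- k p / q) turns into exp(- k p) after raising to the power q,
    which makes the frequency exp(k) ~ 1 / |s - t| contribute about |s - t|^p. *)
Definition trig_coord (p q : R) (i : int * bool) (t : R) : R :=
  expR (- (i.1%:~R * p / q)) * circle i.2 (expR i.1%:~R * t).

Lemma trig_coord0 p q i : trig_coord p q i 0 = 0.
Proof.
by rewrite /trig_coord mulr0; case: i.2; rewrite /= ?sin0 ?cos0 ?subrr mulr0.
Qed.

Lemma trig_coordB p q k b (s t : R) : 0 < q ->
  `|trig_coord p q (k, b) s - trig_coord p q (k, b) t| `^ q =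
  expR (- (k%:~R * p)) *
    `|circle b (expR k%:~R * s) - circle b (expR k%:~R * t)| `^ q.
Proof.
move=> q0; rewrite /trig_coord/= -mulrBr normrM powRM//.
by rewrite (@ger0_norm R (expR _)) ?expR_ge0// -expRM mulNr divfK ?gt_eqF.
Qed.

(** The smallest value of |sin (r / 2)|^q for r = exp(k) |s - t| in [1/e, 1],
    the range of r at the scale used in [trig_coord_lower]. *)
Definition trig_lower (q : R) : R := sin (expR (-1) / 2) `^ q.

Lemma trig_lower_gt0 q : 0 < trig_lower q.
Proof.
apply/powR_gt0/sin_gt0_pihalf; rewrite divr_gt0 ?expR_gt0//=.
have : expR (-1) < 1 :> R by rewrite expR_lt1 ltrN10.
have := @pihalf_ge1 R; lra.
Qed.

Lemma trig_coord_lower (p q s t : R) : 0 < p -> 0 < q ->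
  ((trig_lower q * `|s - t| `^ p)%:E <= \esum_(i in [set: int * bool])
     (`|trig_coord p q i s - trig_coord p q i t| `^ q)%:E)%E.
Proof.
move=> p0 q0; have [->|st] := eqVneq s t.
  by rewrite subrr normr0 powR0 ?gt_eqF// mulr0 esum_ge0.
have d0 : 0 < `|s - t| by rewrite normr_gt0 subr_eq0.
set d := `|s - t| in d0 *.
set m := Num.floor (ln d).
have /andP[m1 m2] := floor_itv (ln d).
rewrite -/m intrD in m1 m2.
(* The scale with exp(-1) <= exp(k) d < 1: then half the angle stays in
   the interval where sin is increasing, and exp(- k p) >= d^p. *)
pose k : int := -1 - m.
have kE : k%:~R = -1 - m%:~R :> R by rewrite /k intrB.
have [b bP] := circle_ge (expR k%:~R * s) (expR k%:~R * t).
apply: le_trans (esum_ge1 _ (k, b) _) => //=.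
rewrite lee_fin trig_coordB// mulrC ler_pM ?powR_ge0//.
  by rewrite -{1}(lnK d0) -expRM ler_expR kE -mulNr ler_wpM2r ?ltW//; lra.
rewrite ge0_ler_powR ?nnegrE ?(ltW q0)//.
  rewrite sin_ge0_pi// divr_ge0 ?expR_ge0//=.
  have : expR (-1) < 1 :> R by rewrite expR_lt1 ltrN10.
  by have := @pi_ge2 R; lra.
apply: le_trans bP.
pose u := expR (k%:~R + ln d) / 2.
have -> : `|sin ((expR k%:~R * s - expR k%:~R * t) / 2)| = `|sin u|.
  have uE : u = `|(expR k%:~R * s - expR k%:~R * t) / 2|.
    rewrite -mulrBr !normrM (@ger0_norm R (expR _)) ?expR_ge0//.
    by rewrite (@ger0_norm R 2^-1)// /u expRD lnK.
  rewrite uE; case: (ler0P (_ / 2)) => _ //; by rewrite sinN normrN.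
apply: le_trans (ler_norm _).
have e1 : expR (k%:~R + ln d) <= 1 by rewrite expR_le1 kE; lra.
have e2 : expR (-1) <= expR (k%:~R + ln d) by rewrite ler_expR kE; lra.
have e3 := expR_gt0 (-1 : R).
have pi1 := @pihalf_ge1 R.
rewrite leNgt ltr_sin -?leNgt ?in_itv/= /u; lra.
Qed.

(** The slower of the two geometric decays: exp(- p) towards high frequencies and
    exp(- (q - p)) towards low ones. *)
Definition trig_rate (p q : R) : R := expR (- Num.min p (q - p)).

(** Four geometric series: two coordinates, each with the nonnegative and the
    negative scales. *)
Definition trig_upper (p q : R) : R := 4 * (expR q / (1 - trig_rate p q)).

Lemma trig_rate_itv (p q : R) : 0 < p -> p < q -> 0 < trig_rate p q < 1.
Proof.
move=> p0 pq; rewrite expR_gt0 expR_lt1 oppr_lt0 lt_min p0 subr_gt0.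
exact: pq.
Qed.

Lemma trig_upper_gt0 (p q : R) : 0 < p -> p < q -> 0 < trig_upper p q.
Proof.
move=> p0 pq; have /andP[_ r1] := trig_rate_itv p q p0 pq.
by rewrite mulr_gt0// divr_gt0 ?expR_gt0// subr_gt0.
Qed.

(** The index j counts scales from the critical one, m being the integer part of
    ln |s - t|.  For j >= 0 the weight decays and the circle difference is
    bounded by 2; for j < 0 the difference is at most exp(j + 1) by the
    Lipschitz bound, and raised to the power q > p it beats the growing weight.
    The exponent on the right is n both for j = n and for j = -(n + 1), so that
    both halves of the sum over j become the same geometric series. *)
Lemma trig_coord_decay (p q s t : R) b : 0 < p -> p < q -> s != t ->
  let m := Num.floor (ln `|s - t|) in
  let c := `|s - t| `^ p * expR q in
  forall j : int,
  `|trig_coord p q (j - m, b) s - trig_coord p q (j - m, b) t| `^ q <=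
  c * trig_rate p q ^+ (if j is Negz n then n else `|j|)%N.
Proof.
move=> p0 pq st m c j; have q0 := lt_trans p0 pq.
have d0 : 0 < `|s - t| by rewrite normr_gt0 subr_eq0.
have /andP[m1 m2] := floor_itv (ln `|s - t|).
rewrite -/m intrD in m1 m2.
rewrite /c -{1}(lnK d0) -expRM trig_coordB//.
set w := `|circle _ _ - _|.
have w_le (h : R) : w <= expR h -> w `^ q <= expR (h * q).
  move=> wh; rewrite expRM ge0_ler_powR ?nnegrE ?(ltW q0) ?expR_ge0//.
  exact: normr_ge0.
have minp : Num.min p (q - p) <= p by rewrite ge_min lexx.
have minqp : Num.min p (q - p) <= q - p by rewrite ge_min lexx orbT.
rewrite -expRM_natl -2!expRD.
(* Comparing logarithms turns both halves into linear inequalities. *)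
suff [h wh hP] : exists2 h, w <= expR h & - ((j - m)%:~R * p) + h * q <=
    ln `|s - t| * p + q + (if j is Negz n then n else `|j|)%N%:R *
      - Num.min p (q - p).
  apply: (@le_trans _ _ (expR (- ((j - m)%:~R * p)) * expR (h * q))).
    by rewrite ler_wpM2l ?expR_ge0// w_le.
  by rewrite -expRD ler_expR.
rewrite intrB; case: j @w w_le => n w w_le.
(* High frequencies: 2 <= exp(1). *)
- exists 1.
    by rewrite (le_trans (circle_le2 _ _ _))// (le_trans _ (expR_ge1Dx _)).
  have n0 : 0 <= n%:R :> R by [].
  rewrite -[(Posz n)%:~R]/(n%:R) /=.
  have : n%:R * Num.min p (q - p) <= n%:R * p by rewrite ler_wpM2l.
  have : m%:~R * p <= ln `|s - t| * p by rewrite ler_wpM2r// ltW.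
  lra.
(* Low frequencies: j + 1 = - n. *)
- exists (- n%:R).
    rewrite (le_trans (circle_lip _ _ _))// -mulrBr normrM.
    rewrite (@ger0_norm R (expR _)) ?expR_ge0// -{1}(lnK d0) -expRD ler_expR.
    rewrite intrB NegzE mulrNz -[n.+1%:~R]/(n.+1%:R) -natr1; lra.
  have n0 : 0 <= n%:R :> R by [].
  rewrite NegzE mulrNz -[n.+1%:~R]/(n.+1%:R) -natr1 /=.
  have : n%:R * Num.min p (q - p) <= n%:R * (q - p) by rewrite ler_wpM2l.
  have : m%:~R * p <= ln `|s - t| * p by rewrite ler_wpM2r// ltW.
  lra.
Qed.

Lemma trig_coord_upper (p q s t : R) : 0 < p -> p < q ->
  (\esum_(i in [set: int * bool])
     (`|trig_coord p q i s - trig_coord p q i t| `^ q)%:E <=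
   (trig_upper p q * `|s - t| `^ p)%:E)%E.
Proof.
move=> p0 pq; have q0 := lt_trans p0 pq; have [->|st] := eqVneq s t.
  rewrite esum1; last by move=> i _; rewrite subrr normr0 powR0 ?gt_eqF.
  by rewrite subrr normr0 powR0 ?gt_eqF// mulr0.
pose m := Num.floor (ln `|s - t|).
pose c := `|s - t| `^ p * expR q.
have c0 : 0 <= c by rewrite mulr_ge0 ?powR_ge0 ?expR_ge0.
have phase b : (\esum_(k in [set: int])
    (`|trig_coord p q (k, b) s - trig_coord p q (k, b) t| `^ q)%:E <=
    (c / (1 - trig_rate p q))%:E + (c / (1 - trig_rate p q))%:E)%E.
  (* Recentre the scales at the critical one. *)
  rewrite (@reindex_esum _ _ _ setT setT (fun j => j - m)); last first.
    split=> // [j1 j2 _ _ /addIr//|k _]; by exists (k + m); rewrite ?addrK.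
  rewrite esum_int; last by move=> k; rewrite lee_fin powR_ge0.
  rewrite -esum_geometric ?trig_rate_itv//.
  apply: leeD; apply: le_esum => n _; rewrite lee_fin.
    exact: (trig_coord_decay p q s t b p0 pq st (Posz n)).
  exact: (trig_coord_decay p q s t b p0 pq st (Negz n)).
rewrite esum_prod_bool; last by move=> i; rewrite lee_fin powR_ge0.
apply: le_trans (leeD (phase true) (phase false)) _.
by rewrite -!EFinD lee_fin /trig_upper /c; lra.
Qed.

End trigonometric_snowflake.

(** * Embedding l_p into l_q *)

Lemma ell_sum_embeds (R : realType) (p q : R) : 0 < p -> p <= q ->
  lipschitz_embeds (@ell_sum R p) (@ell_sum R q).
Proof.
move=> p0; rewrite le_eqVlt => /predU1P[<-|pq].
  exists id; split=> //; exists 1, 1; rewrite ltr01; split=> // x y.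
  by rewrite invr1 mul1r lexx.
have q0 := lt_trans p0 pq.
apply: (@ell_sum_embeds_coordinatewise R (int * bool)%type (0, true)
  (trig_coord p q) p q (trig_lower q) (trig_upper p q)) => //.
- exact: trig_lower_gt0.
- exact: trig_upper_gt0.
- exact: trig_coord0.
- by move=> s t; exact: trig_coord_lower.
- by move=> s t; exact: trig_coord_upper.
Qed.

Theorem proposition5p2 (R : realType) (p q : R) (hp : 0 < p) (hq : 0 < q) :
  [/\ p < q -> q <= 1 ->
        lipschitz_embeds (@ell_dist R p) (@ell_dist R q),
      p <= 1 -> 1 < q ->
        lipschitz_embeds (snowflake (@ell_dist R p) q^-1) (@ell_norm_dist R q)
    & 1 <= p -> p <= q ->
        lipschitz_embeds (snowflake (@ell_norm_dist R p) (p / q))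
          (@ell_norm_dist R q)].
Proof.
have distE r : r <= 1 -> @ell_dist R r = @ell_sum R r.
  by move=> r1; apply/funext => x; apply/funext => y; rewrite /ell_dist r1.
have root : p <= q ->
    lipschitz_embeds (snowflake (@ell_sum R p) q^-1) (@ell_norm_dist R q).
  move=> pq; apply: lipschitz_embeds_snowflake; rewrite ?invr_ge0 ?ltW//.
  - by move=> x y; rewrite ell_sum_ge0 ?ltW.
  - by move=> x y; rewrite ell_sum_ge0 ?ltW.
  - exact: ell_sum_embeds.
split.
- move=> pq q1; rewrite !distE ?(ltW (lt_le_trans pq q1))//.
  exact/ell_sum_embeds/ltW.
- by move=> p1 q1; rewrite distE//; apply/root/ltW/(le_lt_trans p1).
- move=> _ pq.
  suff -> : snowflake (@ell_norm_dist R p) (p / q) =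
      snowflake (@ell_sum R p) q^-1 by exact: root.
  apply/funext => x; apply/funext => y.
  by rewrite /snowflake /ell_norm_dist -powRrM mulKf ?gt_eqF.
Qed.
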